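(* For all integers $k\ge 3$ and $n\ge m\ge 1$, $$kn+1\le r_{bip}(S(n,m);k)\le \max\left\{kn+1,\ \left\lfloor\left(1+\sqrt{1-\frac{2}{k}}\right)km\right\rfloor+1\right\}.$$
   Context: All graphs are finite, simple and undirected. For positive integers $n,m$, the double star $S(n,m)$ is the graph consisting of the disjoint union of two stars $K_{1,n}$ and $K_{1,m}$ together with an edge joining their centers. A $k$-edge-coloring of a graph $G$ is any function $\tau:E(G)\to\{1,\dots,k\}$ (not necessarily proper). The $k$-color bipartite Ramsey number $r_{bip}(H;k)$ of a bipartite graph $H$ is the smallest integer $N$ such that every $k$-edge-coloring of the complete bipartite graph $K_{N,N}$ contains a monochromatic copy of $H$ (as a not necessarily induced subgraph). *)

(* Defs.v *)
From HB Require Import structures.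
From mathcomp Require Import all_boot all_order all_algebra.
From mathcomp Require Import boolp classical_sets reals.
Set Implicit Arguments.
Unset Strict Implicit.
Unset Printing Implicit Defensive.

Record sgraph := SGraph {
  svertex :> finType;
  sedge : rel svertex;
  sedge_sym : symmetric sedge;
  sedge_irrefl : irreflexive sedge }.

Definition edges (G : sgraph) : {set {set G}} :=
  [set [set p.1; p.2] | p : G * G & sedge p.1 p.2].

Definition edge (G : sgraph) := {e : {set G} | e \in edges G}.

Lemma mem_edges (G : sgraph) (x y : G) :
  ([set x; y]%SET \in edges G) = sedge x y.
Proof.
apply/imsetP/idP => [[[u v]]|xy]; last by exists (x, y); rewrite ?inE.
rewrite inE /= => uv /setP exy.
have := exy x; have := exy y; have := exy u; have := exy v.
rewrite !inE !eqxx ?orbT /= => /orP[/eqP vx|/eqP vy] ux /esym yuv /esym xuv.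
  case/orP: ux => /eqP ux; last by rewrite -vx -ux sedge_sym.
  by subst u v; rewrite sedge_irrefl in uv.
case/orP: ux => /eqP ux; first by rewrite -vy -ux.
by subst u v; rewrite sedge_irrefl in uv.
Qed.

(* H is isomorphic to a (not necessarily induced) subgraph of G. *)
Definition contains_copy (G H : sgraph) : Prop :=
  exists f : H -> G, injective f /\ forall x y, sedge x y -> sedge (f x) (f y).

Section ColorClass.
Variables (G : sgraph) (k : nat) (tau : edge G -> 'I_k) (c : 'I_k).

Definition color_class_rel : rel G :=
  fun x y => [exists e : edge G, (val e == [set x; y]%SET) && (tau e == c)].

Lemma color_class_sym : symmetric color_class_rel.
Proof. by move=> x y; rewrite /color_class_rel finset.setUC. Qed.

Lemma color_class_irrefl : irreflexive color_class_rel.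
Proof.
move=> x; apply/existsP => -[e /andP[/eqP ex _]].
by have := valP e; rewrite ex mem_edges sedge_irrefl.
Qed.

Definition color_class : sgraph :=
  SGraph color_class_sym color_class_irrefl.

End ColorClass.

Section CompleteBipartite.
Variables a b : nat.

Definition complete_bipartite_rel : rel ('I_a + 'I_b)%type :=
  fun x y => match x, y with
             | inl _, inr _ | inr _, inl _ => true
             | _, _ => false
             end.

Lemma complete_bipartite_sym : symmetric complete_bipartite_rel.
Proof. by case=> x [] y. Qed.

Lemma complete_bipartite_irrefl : irreflexive complete_bipartite_rel.
Proof. by case. Qed.

Definition complete_bipartite : sgraph :=
  SGraph complete_bipartite_sym complete_bipartite_irrefl.

End CompleteBipartite.

Section DisjointUnion.
Variables G H : sgraph.

Definition disjoint_union_rel : rel (G + H)%type :=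
  fun x y => match x, y with
             | inl u, inl v => sedge u v
             | inr u, inr v => sedge u v
             | _, _ => false
             end.

Lemma disjoint_union_sym : symmetric disjoint_union_rel.
Proof. by case=> x [] y //=; rewrite sedge_sym. Qed.

Lemma disjoint_union_irrefl : irreflexive disjoint_union_rel.
Proof. by case=> x /=; rewrite sedge_irrefl. Qed.

Definition disjoint_union : sgraph :=
  SGraph disjoint_union_sym disjoint_union_irrefl.

End DisjointUnion.

Section AddEdge.
Variables (G : sgraph) (u v : G).

Definition add_edge_rel : rel G :=
  fun x y => sedge x y || (x != y) && ([set x; y] == [set u; v])%SET.

Lemma add_edge_sym : symmetric add_edge_rel.
Proof.
by move=> x y; rewrite /add_edge_rel sedge_sym eq_sym finset.setUC.
Qed.

Lemma add_edge_irrefl : irreflexive add_edge_rel.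
Proof. by move=> x; rewrite /add_edge_rel sedge_irrefl eqxx. Qed.

Definition add_edge : sgraph := SGraph add_edge_sym add_edge_irrefl.

End AddEdge.

Definition star (n : nat) : sgraph := complete_bipartite 1 n.

Definition star_center (n : nat) : star n := inl ord0.

Definition double_star (n m : nat) : sgraph :=
  @add_edge (disjoint_union (star n) (star m))
    (inl (star_center n)) (inr (star_center m)).

Definition bip_arrows (H : sgraph) (k N : nat) : Prop :=
  forall tau : edge (complete_bipartite N N) -> 'I_k,
  exists c : 'I_k, contains_copy (color_class tau c) H.

(* The junk value when no N works is 0; a positive lower bound on
   [r_bip H k] therefore also asserts that some N works. *)
Definition r_bip (H : sgraph) (k : nat) : nat :=
  xget 0 [set N | bip_arrows H k N /\
                  forall M, bip_arrows H k M -> N <= M]%classic.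

Lemma r_bipP (H : sgraph) (k : nat) :
  (exists N, bip_arrows H k N) ->
  bip_arrows H k (r_bip H k) /\
  forall M, bip_arrows H k M -> r_bip H k <= M.
Proof.
move=> [N0 N0P].
have exN : exists N, `[< bip_arrows H k N >] by exists N0; apply/asboolP.
have [N /asboolP NP minN] := ex_minnP exN.
rewrite /r_bip; case: xgetP => [r _ //|/(_ N)[]]; split=> // M /asboolP.
exact: minN.
Qed.

(* Main.v *)
Require Import Defs.
From HB Require Import structures.
From mathcomp Require Import all_boot all_order all_algebra.
From mathcomp Require Import reals.
From mathcomp Require boolp.
From mathcomp Require Import zify ring lra.
Set Implicit Arguments.
Unset Strict Implicit.
Unset Printing Implicit Defensive.
Import Order.TTheory GRing.Theory Num.Theory.
Local Open Scope ring_scope.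

(* Upper bound. A bipartite graph with both sides of size N and no S(n,m) has at
   most max(nN, 2m(N - m)) edges; summing over the colours contradicts N > kn
   and N^2 > 2km(N - m), the latter being the condition that N exceeds the larger
   root of x^2 - 2kmx + 2km^2. For the edge bound, if every degree is at most
   N - m, sum 1/d(u) + 1/d(v) over the edges uv: the total is at most 2N, and each
   term is at least 2/n or 1/m + 1/(N - m). Otherwise the maximum degree D exceeds
   N - m, and the side facing a vertex of degree D has D vertices of degree at
   most m and N - D of degree at most D, hence at most
   Dm + (N - D)D <= 2m(N - m) edges. *)

(** * Edge bounds for bipartite relations without a double star *)

Definition rel_degree (T1 T2 : finType) (E : T1 -> T2 -> bool) (x : T1) : nat :=
  #|[set y | E x y]|.

Definition rel_size (T1 T2 : finType) (E : T1 -> T2 -> bool) : nat :=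
  \sum_x rel_degree E x.

Lemma rel_degreeE (T1 T2 : finType) (E : T1 -> T2 -> bool) (x : T1) :
  rel_degree E x = (\sum_y E x y)%N.
Proof. by rewrite /rel_degree cardsE -sum1_card big_mkcond. Qed.

Lemma rel_size_swap (T1 T2 : finType) (E : T1 -> T2 -> bool) :
  rel_size (fun y x => E x y) = rel_size E.
Proof.
rewrite /rel_size (eq_bigr _ (fun y _ => rel_degreeE _ y)) exchange_big /=.
by apply: eq_bigr => x _; rewrite rel_degreeE.
Qed.

(** Each vertex of positive degree contributes exactly 1, and an isolated one contributes an empty
    sum. *)
Lemma sum_inv_degree_le (T1 T2 : finType) (E : T1 -> T2 -> bool) :
  \sum_x \sum_(y | E x y) (rel_degree E x)%:R^-1 <= #|T1|%:R :> rat.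
Proof.
rewrite -sum1_card natr_sum; apply: ler_sum => x _.
rewrite sumr_const -[X in X <= _]mulr_natl.
have -> : #|[pred y | E x y]| = rel_degree E x by rewrite /rel_degree cardsE.
have [->|d0] := eqVneq (rel_degree E x) 0%N; first by rewrite mul0r.
by rewrite divff // pnatr_eq0.
Qed.

(* [a] and [b] are the degrees of the ends of an edge. Both constraints on [B]
   are the sharp ones: 2 / n = 2N / (nN) and
   1 / m + 1 / (N - m) = 2N / (2m(N - m)). *)
Lemma edge_weight_ge (N n m B a b : nat) :
    (0 < m)%N -> (m < N)%N -> (n * N <= B)%N -> (2 * m * (N - m) <= B)%N ->
    (0 < a)%N -> (0 < b)%N ->
    (a <= n)%N && (b <= n)%N || (a <= N - m)%N && (b <= m)%N
      || (a <= m)%N && (b <= N - m)%N ->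
  2 * N%:R <= B%:R * (a%:R^-1 + b%:R^-1) :> rat.
Proof.
move=> m0 mN Bn Bm a0 b0 ab.
have inv_le (c d : nat) : (0 < c)%N -> (c <= d)%N -> d%:R^-1 <= c%:R^-1 :> rat.
  by move=> c0 cd; rewrite lef_pV2 ?posrE ?ltr0n ?ler_nat //; apply: leq_trans cd.
have two (p q : nat) : (0 < p)%N -> (0 < q)%N -> (2 * p * q <= B)%N ->
    (p + q)%N = N ->
    2 * N%:R <= B%:R * (p%:R^-1 + q%:R^-1) :> rat.
  move=> p0 q0 pqB pqN.
  have -> : p%:R^-1 + q%:R^-1 = N%:R / (p * q)%N%:R :> rat.
    by rewrite -pqN natrD natrM; field; rewrite !pnatr_eq0; lia.
  rewrite mulrA ler_pdivlMr ?ltr0n ?muln_gt0 ?p0 //.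
  by rewrite -!natrM ler_nat; nia.
case/orP: ab => [/orP[]|] /andP[ha hb].
- have n0 : (0 < n)%N by lia.
  apply: (@le_trans _ _ (B%:R * (n%:R^-1 + n%:R^-1))); last first.
    by apply: ler_wpM2l => //; apply: lerD; apply: inv_le.
  have -> : B%:R * (n%:R^-1 + n%:R^-1) = (2 * B%:R) / n%:R :> rat by ring.
  by rewrite ler_pdivlMr ?ltr0n // -!natrM ler_nat; nia.
- apply: (@le_trans _ _ (B%:R * ((N - m)%N%:R^-1 + m%:R^-1))); last first.
    by apply: ler_wpM2l => //; apply: lerD; apply: inv_le.
  by apply: two; lia.
- apply: (@le_trans _ _ (B%:R * (m%:R^-1 + (N - m)%N%:R^-1))); last first.
    by apply: ler_wpM2l => //; apply: lerD; apply: inv_le.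
  by apply: two; lia.
Qed.

Lemma rel_size_le_of_small_degree (T1 T2 : finType) (E : T1 -> T2 -> bool)
    (N n m B : nat) :
    #|T1| = N -> #|T2| = N -> (0 < m)%N -> (m < N)%N ->
    (n * N <= B)%N -> (2 * m * (N - m) <= B)%N ->
    (forall x, rel_degree E x <= N - m)%N ->
    (forall y, rel_degree (fun y x => E x y) y <= N - m)%N ->
    (forall x y, E x y -> n < rel_degree E x ->
       rel_degree (fun y x => E x y) y <= m)%N ->
    (forall x y, E x y -> n < rel_degree (fun y x => E x y) y ->
       rel_degree E x <= m)%N ->
  (rel_size E <= B)%N.
Proof.
set F := fun y x => E x y.
move=> N1 N2 m0 mN Bn Bm dE dF hE hF.
have lower : (2 * N%:R) * (rel_size E)%:R <=
    \sum_x \sum_(y | E x y)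
      B%:R * ((rel_degree E x)%:R^-1 + (rel_degree F y)%:R^-1) :> rat.
  rewrite /rel_size natr_sum mulr_sumr; apply: ler_sum => x _.
  have -> : (2 * N%:R) * (rel_degree E x)%:R = \sum_(y | E x y) 2 * N%:R :> rat.
    by rewrite sumr_const -[RHS]mulr_natr /rel_degree cardsE.
  apply: ler_sum => y xy.
  have dx0 : (0 < rel_degree E x)%N by apply/card_gt0P; exists y; rewrite inE.
  have dy0 : (0 < rel_degree F y)%N by apply/card_gt0P; exists x; rewrite inE.
  apply: (@edge_weight_ge N n m) => //.
  (* An end of degree above [n] forces the other end down to degree [m], so one of the three cases
     of [edge_weight_ge] applies. *)
  case: (leqP (rel_degree E x) n) => [_|/(hE _ _ xy)->]; last by rewrite dE orbT.
  by case: leqP => [//|/(hF _ _ xy)->]; rewrite dF !orbT.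
have upper : \sum_x \sum_(y | E x y)
      B%:R * ((rel_degree E x)%:R^-1 + (rel_degree F y)%:R^-1)
    <= (2 * N%:R) * B%:R :> rat.
  under eq_bigr do rewrite -mulr_sumr big_split /=.
  rewrite -mulr_sumr big_split /= [(_ * N%:R) * _]mulrC; apply: ler_wpM2l => //.
  rewrite [2 * _]mulrDl mul1r; apply: lerD.
    by rewrite -N1; apply: sum_inv_degree_le.
  rewrite (exchange_big_dep xpredT) //= -N2; exact: (sum_inv_degree_le F).
have := le_trans lower upper; rewrite ler_pM2l ?ler_nat //.
by rewrite mulr_gt0 // ltr0n; lia.
Qed.

(* A vertex [x] of large degree [D] forces [D] vertices of degree at most [m]
   on the other side. *)
Lemma rel_size_le_of_large_degree (T1 T2 : finType) (E : T1 -> T2 -> bool)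
    (N m : nat) (x : T1) :
    #|T2| = N -> (3 * m <= N)%N -> (N - m < rel_degree E x)%N ->
    (forall y, rel_degree (fun y x => E x y) y <= rel_degree E x)%N ->
    (forall y, E x y -> rel_degree (fun y x => E x y) y <= m)%N ->
  (rel_size E <= 2 * m * (N - m))%N.
Proof.
set F := fun y x => E x y; set D := rel_degree E x => N2 N3m ltD leD lem.
rewrite -rel_size_swap /rel_size (bigID (fun y => E x y)) /=.
have h1 : (\sum_(y | E x y) rel_degree F y <= D * m)%N.
  rewrite /D /rel_degree cardsE -sum_nat_const; exact: leq_sum.
have h2 : (\sum_(y | ~~ E x y) rel_degree F y <= (N - D) * D)%N.
  apply: (@leq_trans (\sum_(y | ~~ E x y) D)); first exact: leq_sum.
  rewrite sum_nat_const leq_mul2r; apply/orP; right.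
  have -> : #|[pred y | ~~ E x y]| = #|[predC [pred y | E x y]]| by exact: eq_card.
  by rewrite /D /rel_degree cardsE -N2 -(cardC [pred y | E x y]) addKn.
have DN : (D <= N)%N by rewrite -N2 max_card.
(* The sum is [D * (N + m - D)], which decreases in [D] beyond [(N + m) / 2]. Since [3 * m <= N],
   this point is at most [N - m], and at [D = N - m] the value is exactly [2 * m * (N - m)]. *)
apply: leq_trans (leq_add h1 h2) _; clear -ltD DN N3m; nia.
Qed.

(** The last two hypotheses encode the absence of S(n,m): in a bipartite graph the ends of an edge
    share no neighbour, so a copy exists exactly when some edge has one end of degree above [n] and
    the other of degree above [m]. *)
Lemma rel_size_le (T1 T2 : finType) (E : T1 -> T2 -> bool) (N n m : nat) :
    #|T1| = N -> #|T2| = N -> (0 < m)%N -> (3 * m <= N)%N -> (n + m <= N)%N ->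
    (forall x y, E x y -> n < rel_degree E x ->
       rel_degree (fun y x => E x y) y <= m)%N ->
    (forall x y, E x y -> n < rel_degree (fun y x => E x y) y ->
       rel_degree E x <= m)%N ->
  (rel_size E <= maxn (n * N) (2 * m * (N - m)))%N.
Proof.
set F := fun y x => E x y.
move=> N1 N2 m0 N3m nmN hE hF.
have [x0 _] : exists x : T1, x \in T1 by apply/card_gt0P; rewrite N1; lia.
have [y0 _] : exists y : T2, y \in T2 by apply/card_gt0P; rewrite N2; lia.
case: (@arg_maxnP _ x0 xpredT (rel_degree E)) => // x _ maxx.
case: (@arg_maxnP _ y0 xpredT (rel_degree F)) => // y _ maxy.
have [small|] := leqP (maxn (rel_degree E x) (rel_degree F y)) (N - m).
  move: small; rewrite geq_max => /andP[smallx smally].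
  apply: (@rel_size_le_of_small_degree _ _ _ N n m) => //.
  - by lia.
  - exact: leq_maxl.
  - exact: leq_maxr.
  - by move=> x'; apply: leq_trans smallx; apply: maxx.
  - by move=> y'; apply: leq_trans smally; apply: maxy.
move=> large; apply: leq_trans (leq_maxr _ _).
have [yx|/ltnW xy] := leqP (rel_degree F y) (rel_degree E x).
  rewrite (maxn_idPl yx) in large.
  apply: (rel_size_le_of_large_degree N2 N3m large) => [y'|y' xy'].
    by apply: leq_trans yx; apply: maxy.
  (* A degree above [N - m] exceeds [n] because [n + m <= N]. *)
  by apply: hE xy' _; lia.
rewrite (maxn_idPr xy) in large.
rewrite -rel_size_swap.
apply: (rel_size_le_of_large_degree N1 N3m large) => [x'|x' yx'].
  by apply: leq_trans xy; apply: maxx.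
by apply: hF yx' _; lia.
Qed.

(** * Double stars in colour classes *)

Lemma contains_double_star (G : sgraph) (n m : nat) (u v : G) :
    sedge u v -> (forall w, ~~ (sedge u w && sedge v w)) ->
    (n < #|[set w | sedge u w]|)%N -> (m < #|[set w | sedge v w]|)%N ->
  contains_copy G (double_star n m).
Proof.
move=> uv disj ltn ltm.
have vu : sedge v u by rewrite sedge_sym.
(* Each centre is a neighbour of the other and cannot serve as its leaf; the strict degree bounds
   pay for its removal. *)
pose A := [set w | sedge u w] :\ v; pose B := [set w | sedge v w] :\ u.
have leA : (n <= #|A|)%N.
  by move: ltn; rewrite (cardsD1 v) inE uv.
have leB : (m <= #|B|)%N.
  by move: ltm; rewrite (cardsD1 u) inE vu.
pose a (i : 'I_n) : G := enum_val (widen_ord leA i).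
pose b (i : 'I_m) : G := enum_val (widen_ord leB i).
have aP i : (a i != v) && sedge u (a i).
  by have := enum_valP (widen_ord leA i); rewrite !inE.
have bP i : (b i != u) && sedge v (b i).
  by have := enum_valP (widen_ord leB i); rewrite !inE.
have a_inj : injective a by move=> i j /enum_val_inj/(congr1 val)/= /val_inj.
have b_inj : injective b by move=> i j /enum_val_inj/(congr1 val)/= /val_inj.
have au i : a i != u.
  by apply/eqP => e; have := aP i; rewrite e sedge_irrefl andbF.
have bv i : b i != v.
  by apply/eqP => e; have := bP i; rewrite e sedge_irrefl andbF.
have ab i j : a i != b j.
  apply/eqP => e; have := disj (a i).
  by case/andP: (aP i) => _ ->; rewrite e; case/andP: (bP j) => _ ->.
have u_v : u != v by apply/eqP => e; rewrite e sedge_irrefl in uv.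
pose f (w : double_star n m) : G :=
  match w with
  | inl (inl _) => u | inl (inr i) => a i
  | inr (inl _) => v | inr (inr i) => b i
  end.
exists f; split.
  move=> [[w|w]|[w|w]] [[w'|w']|[w'|w']] //= e;
  first [ by rewrite (ord1 w) (ord1 w') | by rewrite (a_inj _ _ e)
        | by rewrite (b_inj _ _ e)
        | by move: (u_v); rewrite e eqxx | by move: (u_v); rewrite -e eqxx
        | by move: (au w); rewrite e eqxx | by move: (au w'); rewrite -e eqxx
        | by move: (bv w); rewrite e eqxx | by move: (bv w'); rewrite -e eqxx
        | by move: (bP w); rewrite e eqxx | by move: (bP w'); rewrite -e eqxx
        | by move: (aP w); rewrite e eqxx | by move: (aP w'); rewrite -e eqxx
        | by move: (ab w w'); rewrite e eqxx | by move: (ab w' w); rewrite -e eqxx ].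
move=> x y /orP[|/andP[xy /eqP exy]].
  case: x y => [[w|w]|[w|w]] [[w'|w']|[w'|w']] //= _;
  first [ by case/andP: (aP w') | by case/andP: (bP w')
        | by rewrite sedge_sym; case/andP: (aP w)
        | by rewrite sedge_sym; case/andP: (bP w) ].
move/setP: exy => exy; have := exy x; have := exy y; rewrite !inE !eqxx ?orbT /=.
move=> /esym/orP[] /eqP ey /esym/orP[] /eqP ex; rewrite ex ey //=.
  by rewrite ex ey eqxx in xy.
by rewrite ex ey eqxx in xy.
Qed.

(* Colouring the edge [ij] by [i + j mod k] leaves every colour class with
   maximum degree at most [n] as soon as [N <= k * n]. *)
Lemma bip_arrows_double_star_ge (k n m N : nat) :
  (0 < k)%N -> bip_arrows (double_star n m) k N -> (k * n < N)%N.
Proof.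
case: k => // k _ arr; rewrite ltnNge; apply/negP => leN.
pose num (x : complete_bipartite N N) : nat :=
  match x with inl i => i | inr j => j end.
(* An edge is an unordered pair, so its colour is read from the symmetric sum of the indices of its
   two ends. *)
pose tau (e : edge (complete_bipartite N N)) : 'I_k.+1 :=
  inord ((\sum_(x in val e) num x) %% k.+1).
have [c [f [f_inj f_edge]]] := arr tau.
pose H := double_star n m.
pose ctr : H := inl (inl ord0); pose lf (i : 'I_n) : H := inl (inr i).
(* Only one centre matters: its [n.+1] neighbours are its [n] leaves and the other centre, placed at
   index 0. *)
pose nb (i : 'I_n.+1) : H :=
  if unlift ord0 i is Some j then lf j else inr (inl ord0).
have nb_inj : injective nb.
  move=> i j; rewrite /nb.
  case: unliftP => [i' ->|->]; case: unliftP => [j' ->|->] //.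
  by move=> [->].
have nb_edge i : sedge ctr (nb i).
  rewrite /nb; case: unliftP => [i' _|_] //=.
  by rewrite /add_edge_rel /= eqxx.
have colP x y : sedge (x : color_class tau c) y ->
    sedge (x : complete_bipartite N N) y /\ ((num x + num y) %% k.+1 = c)%N.
  move=> /existsP[e /andP[/eqP exy /eqP ec]].
  have xy : sedge (x : complete_bipartite N N) y.
    by rewrite -mem_edges -exy; apply: valP.
  split=> //; rewrite -ec /tau inordK ?ltn_mod // exy big_setU1 ?big_set1 //=.
  by rewrite inE; apply/eqP => exy'; rewrite exy' sedge_irrefl in xy.
pose g i : complete_bipartite N N := f (nb i).
have gP i := colP _ _ (f_edge _ _ (nb_edge i)).
(* [num] forgets the side, but all neighbours of [f ctr] lie on the same side. *)
have num_inj i j : num (g i) = num (g j) -> i = j.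
  move=> e; apply/nb_inj/f_inj; move: (gP i).1 (gP j).1 e; rewrite /g.
  case: (f ctr) => z; case: (f (nb i)) => x //; case: (f (nb j)) => y //= _ _.
    by move=> /val_inj ->.
  by move=> /val_inj ->.
have num_lt i : (num (g i) < k.+1 * n)%N.
  by apply: leq_trans leN; rewrite /num; case: (g i).
(* All [num (g i)] agree modulo [k.+1], since adding [num (f ctr)] gives the colour [c]. Their
   quotients are thus [n.+1] distinct numbers below [n]. *)
have q_lt i : (num (g i) %/ k.+1 < n)%N by rewrite ltn_divLR // mulnC.
have q_inj : injective (fun i => Ordinal (q_lt i)).
  move=> i j [eq_q]; apply: num_inj.
  rewrite (divn_eq (num (g i)) k.+1) (divn_eq (num (g j)) k.+1) eq_q.
  congr (_ + _)%N; apply/eqP; rewrite -(eqn_modDl (num (f ctr))).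
  by rewrite (gP i).2 (gP j).2.
by have := leq_card _ q_inj; rewrite !card_ord ltnn.
Qed.

Lemma bip_arrows_double_star (k n m N : nat) :
    (0 < m)%N -> (3 * m <= N)%N -> (n + m <= N)%N ->
    (k * n < N)%N -> (2 * k * m * (N - m) < N * N)%N ->
  bip_arrows (double_star n m) k N.
Proof.
move=> m0 N3m nmN knN kmN tau.
apply: boolp.contrapT => noc.
pose E c (i j : 'I_N) := @sedge (color_class tau c) (inl i) (inr j).
have EX c (x y : color_class tau c) : sedge x y ->
    sedge (x : complete_bipartite N N) y.
  by move=> /existsP[e /andP[/eqP exy _]]; rewrite -mem_edges -exy; apply: valP.
have disj c (u v w : color_class tau c) : sedge u v -> ~~ (sedge u w && sedge v w).
  move=> /EX uv; apply/negP => /andP[/EX uw /EX vw].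
  by move: u v w uv uw vw => [u|u] [v|v] [w|w].
have dl c i : (rel_degree (E c) i <=
    #|[set w | @sedge (color_class tau c) (inl i) w]|)%N.
  rewrite /rel_degree -(card_imset _ (@inr_inj 'I_N 'I_N)); apply/subset_leq_card/subsetP.
  by move=> _ /imsetP[j + ->]; rewrite !inE.
have dr c j : (rel_degree (fun j i => E c i j) j <=
    #|[set w | @sedge (color_class tau c) (inr j) w]|)%N.
  rewrite /rel_degree -(card_imset _ (@inl_inj 'I_N 'I_N)); apply/subset_leq_card/subsetP.
  by move=> _ /imsetP[i + ->]; rewrite !inE sedge_sym.
have size_le c : (rel_size (E c) <= maxn (n * N) (2 * m * (N - m)))%N.
  apply: rel_size_le; rewrite ?card_ord // => i j ij lt_n; rewrite leqNgt;
    apply/negP => lt_m; apply: noc; exists c.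
  - apply: (@contains_double_star _ _ _ (inl i : color_class tau c) (inr j)) => //.
    + by move=> w; apply: disj.
    + exact: leq_trans lt_n (dl _ _).
    + exact: leq_trans lt_m (dr _ _).
  - have ji : @sedge (color_class tau c) (inr j) (inl i) by rewrite sedge_sym.
    apply: (@contains_double_star _ _ _ (inr j : color_class tau c) (inl i)) => //.
    + by move=> w; apply: disj.
    + exact: leq_trans lt_n (dr _ _).
    + exact: leq_trans lt_m (dl _ _).
have covered i j : (1 <= \sum_c E c i j)%N.
  have ij := @mem_edges (complete_bipartite N N) (inl i) (inr j).
  (* Every pair [i], [j] is an edge and lies in the class of its own colour, so the classes together
     have at least [N * N] edges. *)
  pose e : edge (complete_bipartite N N) := exist _ _ ij.
  rewrite (bigD1 (tau e)) //= (_ : E _ i j = true) //.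
  by apply/existsP; exists e; rewrite !eqxx.
have : (N * N <= \sum_c rel_size (E c))%N.
  rewrite /rel_size exchange_big /=.
  under eq_bigr do under eq_bigr do rewrite rel_degreeE.
  under eq_bigr do rewrite exchange_big /=.
  rewrite -[X in (X * X <= _)%N]card_ord -sum_nat_const; apply: leq_sum => i _.
  by rewrite -[X in (X <= _)%N]muln1 -sum_nat_const; apply: leq_sum => j _.
apply/negP; rewrite -ltnNge.
apply: (@leq_ltn_trans (k * maxn (n * N) (2 * m * (N - m)))).
  by rewrite -[X in (X * _)%N]card_ord -sum_nat_const; apply: leq_sum.
by rewrite maxnMr gtn_max; apply/andP; split; nia.
Qed.

(** * From the quadratic condition to the closed form *)

Theorem corollary1p5 (R : realType) (k n m : nat)
    (hk : (3 <= k)%N) (hmn : (m <= n)%N) (hm : (1 <= m)%N) :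
  (k * n + 1)%N%:Z <= (r_bip (double_star n m) k)%:Z <=
    Num.max (k * n + 1)%N%:Z
      (Num.floor ((1 + Num.sqrt (1 - 2 / k%:R)) * k%:R * m%:R : R) + 1).
Proof.
set s := Num.sqrt _; set x := (X in Num.floor X).
set Z := Num.max _ _.
have Zge : (k * n + 1)%N%:Z <= Z by rewrite le_max lexx.
have [N ZN] : exists N : nat, Z = N%:Z.
  by exists `|Z|%N; rewrite gez0_abs //; apply: le_trans Zge.
have knN : (k * n < N)%N by move: Zge; rewrite ZN lez_nat addn1.
(* The [+ 1] after the floor makes this strict even when [x] is an integer. *)
have xN : x < N%:R.
  apply: (lt_le_trans (floorD1_gt x)).
  by rewrite -[N%:R]/(N%:Z%:~R) ler_int -ZN le_max lexx orbT.
have k0 : 0 < k%:R :> R by rewrite ltr0n; lia.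
have k3 : 3 <= k%:R :> R by rewrite ler_nat.
have m0 : 0 < m%:R :> R by rewrite ltr0n.
have s0 : 0 <= s by exact: sqrtr_ge0.
have s2 : s ^+ 2 = 1 - 2 / k%:R.
  by rewrite sqr_sqrtr // subr_ge0 ler_pdivrMr //; lra.
(* Completing the square turns the goal into [(N - k * m)^2 > k * (k - 2) * m^2], whose right side
   is [(s * k * m)^2]; [x < N] is the square root of this inequality. *)
have kmN : (2 * k * m * (N - m) < N * N)%N.
  rewrite -(ltr_nat R) !natrM natrB; last by nia.
  have ks2 : k%:R * s ^+ 2 = k%:R - 2 by rewrite s2; field; rewrite gt_eqF.
  have h1 : 0 <= s * k%:R * m%:R by rewrite !mulr_ge0 // ltW.
  have h2 : s * k%:R * m%:R < N%:R - k%:R * m%:R.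
    by move: xN; rewrite /x; lra.
  have h3 : (s * k%:R * m%:R) ^+ 2 < (N%:R - k%:R * m%:R) ^+ 2.
    by rewrite ltr_pXn2r // nnegrE // ltW // (le_lt_trans h1).
  have h4 : (s * k%:R * m%:R) ^+ 2 = (k%:R - 2) * k%:R * m%:R ^+ 2.
    by rewrite -ks2; ring.
  by rewrite h4 in h3; rewrite -subr_gt0; lra.
have arrN : bip_arrows (double_star n m) k N.
  by apply: bip_arrows_double_star => //; nia.
(* [arrN] excludes the junk value 0, so [r_bip] itself has the arrowing property and the lower bound
   applies to it. *)
have [arr_r min_r] := r_bipP (ex_intro _ N arrN).
rewrite ZN !lez_nat addn1 min_r // andbT.
by apply: (bip_arrows_double_star_ge _ arr_r); lia.
Qed.
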